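(* Let $M$ be a submanifold of a Sasakian manifold, tangent to $\xi$. For all tangent vector fields $X,Y$ on $M$, $$(\bar\nabla_XP)Y=A_{FY}X+t\,h(X,Y)+g(X,Y)\xi-\eta(Y)X .$$ Hence $P$ is parallel if and only if the right-hand side vanishes identically (for all tangent $X,Y$).
   Context: A Sasakian manifold $(\overline M^{2m+1},\phi,\xi,\eta,g)$ consists of a Riemannian metric $g$ with Levi-Civita connection $\widetilde\nabla$, a $(1,1)$-tensor field $\phi$, a vector field $\xi$ (the Reeb field) and a 1-form $\eta$ with $\phi^2X=-X+\eta(X)\xi$, $\eta(\xi)=1$, $\phi\xi=0$, $g(\phi X,\phi Y)=g(X,Y)-\eta(X)\eta(Y)$ and $(\widetilde\nabla_X\phi)Y=g(X,Y)\xi-\eta(Y)X$. Let $M$ be an immersed submanifold with $\xi\in\Gamma(TM)$, induced Levi-Civita connection $\nabla$, second fundamental form $h$, shape operators $A_V$ and normal connection $\nabla^\perp$, so $\widetilde\nabla_XY=\nabla_XY+h(X,Y)$ and $\widetilde\nabla_XV=-A_VX+\nabla^\perp_XV$. For $X\in TM$ and $V\in T^\perp M$ write $\phi X=PX+FX$ and $\phi V=tV+fV$ with $PX,tV$ tangent and $FX,fV$ normal. Define $(\bar\nabla_XP)Y=\nabla_X(PY)-P\nabla_XY$; $P$ is parallel if $\bar\nabla P=0$. *)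

(* Defs.v *)
From HB Require Import structures.
From mathcomp Require Import all_boot all_order all_algebra.
From mathcomp Require Import all_classical all_reals all_analysis.

Set Implicit Arguments.
Unset Strict Implicit.
Unset Printing Implicit Defensive.

Import Order.TTheory GRing.Theory Num.Theory.
Import numFieldNormedType.Exports.

Local Open Scope classical_set_scope.
Local Open Scope ring_scope.

(* C^k maps on an open set [U] of a finite-dimensional space: C^{k+1} means
   Frechet differentiable with all directional derivatives of class C^k. *)
Fixpoint Ck (R : realType) (V W : normedModType R) (k : nat)
    (U : set V) (f : V -> W) : Prop :=
  match k with
  | 0%N => forall x, U x -> {for x, continuous f}
  | k'.+1 => (forall x, U x -> differentiable f x) /\
             (forall v, Ck k' U (fun x => 'd f x v))
  end.

Definition smooth_on (R : realType) (V W : normedModType R)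
    (U : set V) (f : V -> W) : Prop := forall k, Ck k U f.

Record chart (R : realType) (T : topologicalType) (n : nat) := Chart {
  cdom : set T;
  cmap :> T -> 'rV[R]_n;
  cinv : 'rV[R]_n -> T;
  cdom_open : open cdom;
  cimg_open : open (cmap @` cdom);
  cmapK : {in cdom, cancel cmap cinv};
  cmap_continuous : {in cdom, continuous cmap};
  cinv_continuous : {in cmap @` cdom, continuous cinv} }.

(* The atlas is the family of the [chart_at p]; [chart_at p] also serves to
   identify the tangent space at [p] with R^n. *)
Record manifold (R : realType) (n : nat) := Manifold {
  point :> topologicalType;
  manifold_hausdorff : hausdorff_space point;
  manifold_second_countable : @second_countable point;
  chart_at : point -> chart R point n;
  mem_chart_at : forall p, cdom (chart_at p) p;
  chart_at_compat : forall p q,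
    smooth_on (chart_at p @` (cdom (chart_at p) `&` cdom (chart_at q)))
              (chart_at q \o cinv (chart_at p)) }.

(* In all the [_on U] definitions below, [U] is meant to be open. *)
Definition smooth_fct_on (R : realType) (n : nat) (M : manifold R n)
    (W : normedModType R) (U : set M) (f : M -> W) : Prop :=
  forall q : M, smooth_on (chart_at q @` (cdom (chart_at q) `&` U))
                          (f \o cinv (chart_at q)).

Definition smooth_fct_near (R : realType) (n : nat) (M : manifold R n)
    (W : normedModType R) (p : M) (f : M -> W) : Prop :=
  exists2 U : set M, open_nbhs p U & smooth_fct_on U f.

(* A tangent vector at [p] is given by its components, of type ['rV[R]_n], in
   the chart [chart_at p].  [der f p v] is the derivative of the vector-valued
   function [f] at [p] along [v]; in particular [der (chart_at q) p v] is the
   row of components of [v] in the chart [chart_at q]. *)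
Definition der (R : realType) (n : nat) (M : manifold R n)
    (W : normedModType R) (f : M -> W) (p : M) (v : 'rV[R]_n) : W :=
  'd (f \o cinv (chart_at p)) (chart_at p p) v.

Definition smooth_map (R : realType) (n k : nat)
    (M : manifold R n) (N : manifold R k) (i : M -> N) : Prop :=
  continuous i /\
  forall q : N, smooth_fct_on (i @^-1` cdom (chart_at q)) (chart_at q \o i).

Definition tmap (R : realType) (n k : nat)
    (M : manifold R n) (N : manifold R k) (i : M -> N)
    (p : M) (v : 'rV[R]_n) : 'rV[R]_k :=
  der (chart_at (i p) \o i) p v.

Definition immersion (R : realType) (n k : nat)
    (M : manifold R n) (N : manifold R k) (i : M -> N) : Prop :=
  smooth_map i /\ forall p, injective (tmap i p).

(* A vector field along [i : M -> N] is a section of the pull-back of TN: its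
   value at [p] is a tangent vector to N at [i p].  Vector fields on M are
   the vector fields along the identity of M. *)
Definition field_along_on (R : realType) (n k : nat)
    (M : manifold R n) (N : manifold R k) (i : M -> N)
    (U : set M) (Z : M -> 'rV[R]_k) : Prop :=
  forall q : N, smooth_fct_on (U `&` i @^-1` cdom (chart_at q))
                              (fun p => der (chart_at q) (i p) (Z p)).

Definition field_along_near (R : realType) (n k : nat)
    (M : manifold R n) (N : manifold R k) (i : M -> N)
    (p : M) (Z : M -> 'rV[R]_k) : Prop :=
  exists2 U : set M, open_nbhs p U & field_along_on i U Z.

Definition vfield_on (R : realType) (n : nat) (M : manifold R n)
    (U : set M) (X : M -> 'rV[R]_n) : Prop :=
  field_along_on (idfun : M -> M) U X.

Definition vfield_near (R : realType) (n : nat) (M : manifold R n)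
    (p : M) (X : M -> 'rV[R]_n) : Prop :=
  field_along_near (idfun : M -> M) p X.

Definition vfield (R : realType) (n : nat) (M : manifold R n)
    (X : M -> 'rV[R]_n) : Prop :=
  vfield_on [set: M] X.

(* Connections on the pull-back bundle i^*TN.  [D p v Z] is the covariant
   derivative at [p] of the field [Z] along [v]; as usual it is defined on
   fields that are only smooth in a neighbourhood of [p], and depends only on
   their germs at [p]; its values on other functions [Z] are irrelevant. *)
Record is_connection_along (R : realType) (n k : nat)
    (M : manifold R n) (N : manifold R k) (i : M -> N)
    (D : M -> 'rV[R]_n -> (M -> 'rV[R]_k) -> 'rV[R]_k) : Prop := {
  connection_linear : forall p Z, field_along_near i p Z ->
    linear (fun v => D p v Z);
  connectionD : forall p v Z1 Z2,
    field_along_near i p Z1 -> field_along_near i p Z2 ->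
    D p v (fun q => Z1 q + Z2 q) = D p v Z1 + D p v Z2;
  connection_leibniz : forall p v (f : M -> R) Z,
    smooth_fct_near p f -> field_along_near i p Z ->
    D p v (fun q => f q *: Z q) = der f p v *: Z p + f p *: D p v Z;
  connection_local : forall p v Z1 Z2,
    field_along_near i p Z1 -> (\forall q \near p, Z1 q = Z2 q) ->
    D p v Z1 = D p v Z2;
  connection_smooth : forall (U : set M) X Z, open U ->
    vfield_on U X -> field_along_on i U Z ->
    field_along_on i U (fun p => D p (X p) Z) }.

Definition is_connection (R : realType) (n : nat) (M : manifold R n)
    (nabla : M -> 'rV[R]_n -> (M -> 'rV[R]_n) -> 'rV[R]_n) : Prop :=
  is_connection_along (idfun : M -> M) nabla.

(* The connection induced on i^*TN by a connection on N. *)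
Definition is_pullback_connection (R : realType) (n k : nat)
    (M : manifold R n) (N : manifold R k) (i : M -> N)
    (nabla : N -> 'rV[R]_k -> (N -> 'rV[R]_k) -> 'rV[R]_k)
    (D : M -> 'rV[R]_n -> (M -> 'rV[R]_k) -> 'rV[R]_k) : Prop :=
  is_connection_along i D /\
  forall p v (Y : N -> 'rV[R]_k), vfield_near (i p) Y ->
    D p v (Y \o i) = nabla (i p) (tmap i p v) Y.

Record is_riemannian_metric (R : realType) (n : nat) (M : manifold R n)
    (g : M -> 'rV[R]_n -> 'rV[R]_n -> R) : Prop := {
  metric_linear : forall p w, scalar (fun v => g p v w);
  metric_sym : forall p v w, g p v w = g p w v;
  metric_pos : forall p v, v != 0 -> 0 < g p v v;
  metric_smooth : forall (U : set M) X Y, open U ->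
    vfield_on U X -> vfield_on U Y ->
    smooth_fct_on U (fun p => g p (X p) (Y p)) }.

(* The torsion-free condition is [nabla_X Y - nabla_Y X = [X, Y]], where
   [[X, Y] f = X (Y f) - Y (X f)]. *)
Record is_levi_civita (R : realType) (n : nat) (M : manifold R n)
    (g : M -> 'rV[R]_n -> 'rV[R]_n -> R)
    (nabla : M -> 'rV[R]_n -> (M -> 'rV[R]_n) -> 'rV[R]_n) : Prop := {
  levi_civita_connection : is_connection nabla;
  levi_civita_torsion_free : forall (p : M) X Y (f : M -> R),
    vfield_near p X -> vfield_near p Y -> smooth_fct_near p f ->
    der f p (nabla p (X p) Y - nabla p (Y p) X) =
    der (fun q => der f q (Y q)) p (X p) - der (fun q => der f q (X q)) p (Y p);
  levi_civita_metric : forall (p : M) v Y Z,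
    vfield_near p Y -> vfield_near p Z ->
    der (fun q => g q (Y q) (Z q)) p v =
    g p (nabla p v Y) (Z p) + g p (Y p) (nabla p v Z) }.

Record sasakian (R : realType) (m : nat) (N : manifold R m.*2.+1) := Sasakian {
  metric : N -> 'rV[R]_(m.*2.+1) -> 'rV[R]_(m.*2.+1) -> R;
  lc : N -> 'rV[R]_(m.*2.+1) -> (N -> 'rV[R]_(m.*2.+1)) -> 'rV[R]_(m.*2.+1);
  phi : N -> 'rV[R]_(m.*2.+1) -> 'rV[R]_(m.*2.+1);
  xi : N -> 'rV[R]_(m.*2.+1);
  eta : N -> 'rV[R]_(m.*2.+1) -> R;
  sasakian_metric : is_riemannian_metric metric;
  sasakian_lc : is_levi_civita metric lc;
  phi_linear : forall p, linear (phi p);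
  phi_smooth : forall (U : set N) X, open U ->
    vfield_on U X -> vfield_on U (fun p => phi p (X p));
  xi_smooth : vfield xi;
  eta_linear : forall p, scalar (eta p);
  eta_smooth : forall (U : set N) X, open U ->
    vfield_on U X -> smooth_fct_on U (fun p => eta p (X p));
  phi_phi : forall p v, phi p (phi p v) = - v + eta p v *: xi p;
  eta_xi : forall p, eta p (xi p) = 1;
  phi_xi : forall p, phi p (xi p) = 0;
  metric_phi : forall p v w,
    metric p (phi p v) (phi p w) = metric p v w - eta p v * eta p w;
  lc_phi : forall p v Y, vfield_near p Y ->
    lc p v (fun q => phi q (Y q)) - phi p (lc p v Y) =
    metric p v (Y p) *: xi p - eta p (Y p) *: v }.

Section Submanifold.
Variables (R : realType) (n m : nat).
Variables (M : manifold R n) (N : manifold R m.*2.+1).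
Variables (S : sasakian N) (i : M -> N).
Local Notation TM := 'rV[R]_n.
Local Notation TN := 'rV[R]_(m.*2.+1).

Definition induced_metric (p : M) (u v : TM) : R :=
  metric S (i p) (tmap i p u) (tmap i p v).

Definition normal_vector (p : M) (w : TN) : Prop :=
  forall u : TM, metric S (i p) w (tmap i p u) = 0.

(* For an immersion, [tan_part p w] is the unique tangent vector to M such that
   [w - tmap i p (tan_part p w)] is normal. *)
Definition tan_part (p : M) (w : TN) : TM :=
  xget 0 [set u : TM | normal_vector p (w - tmap i p u)].

Definition nor_part (p : M) (w : TN) : TN := w - tmap i p (tan_part p w).

Definition push (X : M -> TM) : M -> TN := fun p => tmap i p (X p).

Definition tangent_to_reeb : Prop :=
  forall p, exists u : TM, tmap i p u = xi S (i p).

(* phi X = P X + F X and phi V = t V + f V, with P, F, t written opP, opF, opt. *)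
Definition opP (p : M) (u : TM) : TM := tan_part p (phi S (i p) (tmap i p u)).
Definition opF (p : M) (u : TM) : TN := nor_part p (phi S (i p) (tmap i p u)).
Definition opt (p : M) (w : TN) : TM := tan_part p (phi S (i p) w).

(* [D] is the pull-back to M of the Levi-Civita connection of N, [nabla] the
   Levi-Civita connection of M. *)
Variable D : M -> TM -> (M -> TN) -> TN.
Variable nabla : M -> TM -> (M -> TM) -> TM.

Definition second_fundamental_form (X Y : M -> TM) (p : M) : TN :=
  nor_part p (D p (X p) (push Y)).

(* Weingarten formula: [- A_V X] is the tangential part of [D_X V]. *)
Definition shape_operator (V : M -> TN) (X : M -> TM) (p : M) : TM :=
  - tan_part p (D p (X p) V).

Definition nablaP (X Y : M -> TM) (p : M) : TM :=
  nabla p (X p) (fun q => opP q (Y q)) - opP p (nabla p (X p) Y).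

Definition P_parallel : Prop :=
  forall X Y, vfield (M := M) X -> vfield (M := M) Y ->
  forall p, nablaP X Y p = 0.

End Submanifold.

(* Main.v *)
From HB Require Import structures.
Require Import Defs.
From mathcomp Require Import all_boot all_order perm all_algebra.
From mathcomp Require Import all_classical all_reals all_analysis.

(** The identity is the tangential part of the Sasakian equation
[(nabla_X phi) Y = g(X, Y) xi - eta(Y) X], read along the immersion [i].  Let
[D] be the connection pulled back to the fields along [i].  Applying that
equation to the field [i_* Y] gives
[[
   D_X (phi (i_* Y)) = phi (D_X (i_* Y)) + g(X, Y) xi - eta(Y) i_* X.
]]
On the left [phi (i_* Y) = i_* (P Y) + F Y], so the tangential part is
[nabla_X (P Y) - A_{FY} X]; on the right [D_X (i_* Y) = i_* (nabla_X Y) + h(X, Y)],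
so the tangential part is
[P (nabla_X Y) + t h(X, Y) + g(X, Y) xi - eta(Y) X].  Comparing the two proves
the formula, and the criterion for [P] to be parallel is a restatement of it.

Three facts carry this computation.

- The Sasakian equation holds for all fields along [i], not only for the
  restrictions to [M] of fields of [N] ([pullback_phi]).  Near a point a field
  along [i] is a combination, with smooth coefficients, of restrictions of
  coordinate fields of [N]; this yields the induction principle
  [field_along_ind], by which statements that are additive and compatible with
  multiplication by functions need only be checked on restrictions.

- The tangential part of [D_X (i_* Y)] is [nabla_X Y] ([tan_part_pullback]).
  This is the uniqueness of the Levi-Civita connection: the difference [T] of
  the two sides is symmetric, because both have the torsion-free property
  ([pullback_torsion_free]), and [g(T(X, Y), Z)] is skew in [Y] and [Z], because
  both are metric ([pullback_metric_compatible]); hence it is zero.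

- [P Y] and [F Y] are smooth, without which the axioms of a connection say
  nothing about their derivatives ([vfield_near_tan_part]).  The orthogonal
  projection is given in coordinates by the inverse of the Gram matrix of the
  coordinate frame, whose entries are rational in smooth functions.

All three rest on a calculus of C^k maps on open sets of normed spaces, which
is transported to manifolds through charts. *)

Import Order.TTheory GRing.Theory Num.Theory.
Import numFieldNormedType.Exports.

Local Open Scope classical_set_scope.
Local Open Scope ring_scope.
Set Implicit Arguments.
Unset Strict Implicit.
Unset Printing Implicit Defensive.

(** * Differentials depend on germs *)

Section DiffGerm.
Variables (R : realType) (V W : normedModType R).
Implicit Types (f g : V -> W) (x : V).

(** The Taylor remainders of [f] and [g] at [x] agree near [x], so the
differential of [f] is also one for [g]. *)
Lemma near_eq_differentiable f g x :
  (\forall y \near x, f y = g y) -> differentiable f x -> differentiable g x.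
Proof.
move=> fg df; have dfc := diff_continuous df; suff gE :
    g \o shift x = cst (g x) + 'd f x +o_ 0 id.
  by apply/diff_locallyP; rewrite (diff_unique dfc gE).
have dfE' := diff_locally df.
apply/eqaddoP => e e0; move/eqaddoP: dfE' => /(_ e e0) H.
have fg' : \forall h \near (0 : V), f (h + x) = g (h + x).
  by move: fg; rewrite (near_shift 0 x) subr0.
near=> h.
have -> : (g \o shift x - (cst (g x) + 'd f x)) h =
  (f \o shift x - (cst (f x) + 'd f x)) h.
  rewrite /= !fctE /= (nbhs_singleton fg); congr (_ - _).
  by rewrite -(near fg' h).
by near: h.
Unshelve. all: by end_near. Qed.

Lemma near_eq_diff f g x :
  (\forall y \near x, f y = g y) -> differentiable f x ->
  'd f x = 'd g x :> (V -> W).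
Proof.
move=> fg df; have dg := near_eq_differentiable fg df.
by apply/funext => v; rewrite -!deriveE//; exact: near_eq_derive.
Qed.

(** The product rule, as a special case of the differential of a continuous
bilinear map. *)
Lemma is_diff_scale (a : V -> R) f x :
  differentiable a x -> differentiable f x ->
  is_diff x (fun y => a y *: f y)
            (fun v => 'd a x v *: f x + a x *: 'd f x v).
Proof.
move=> da df.
have bil : bilinear_for (GRing.Scale.Law.clone _ _ *:%R _)
    (GRing.Scale.Law.clone _ _ *:%R _) (fun (c : R) (w : W) => c *: w).
  split=> [w c u v | c d u v] /=; first by rewrite scalerDl scalerA.
  by rewrite scalerDr !scalerA mulrC.
pose B := bilinear_isBilinear.Build R R W W _ _ (fun (c : R) (w : W) => c *: w) bil.
pose b : {bilinear R -> W -> W} := HB.pack (fun (c : R) (w : W) => c *: w) B.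
have bc : continuous (fun q : R * W => b q.1 q.2) by exact: scale_continuous.
have dp := differentiable_pair da df.
have db := differentiable_bilin (a x, f x) bc.
apply: DiffDef; first exact: (@differentiable_comp _ _ _ _ _ _ x dp db).
rewrite (_ : (fun y => _) = (fun q : R * W => b q.1 q.2) \o (fun y => (a y, f y))) //.
rewrite (diff_comp dp db) diff_pair // (diff_bilin _ bc); apply/funext => v /=.
by rewrite addrC.
Qed.

End DiffGerm.

(** * Calculus of C^k maps *)

Section CkCalculus.
Variable R : realType.
Implicit Types V W Z : normedModType R.

Lemma open_near (V : topologicalType) (U : set V) (P : V -> Prop) x :
  open U -> U x -> (forall y, U y -> P y) -> \forall y \near x, P y.
Proof. by move=> oU Ux UP; apply: filterS UP _; apply: open_nbhs_nbhs. Qed.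

Lemma Ck_ext V W k (U : set V) (f g : V -> W) :
  open U -> (forall x, U x -> f x = g x) -> Ck k U f -> Ck k U g.
Proof.
move=> oU; elim: k f g => [|k IH] f g fg /=.
  move=> cf x Ux; have fgx := open_near oU Ux fg.
  rewrite /prop_for /continuous_at -(fg x Ux).
  by apply: cvg_trans (cf x Ux); exact: near_eq_cvg.
move=> [df Cf]; split=> [x Ux|v].
  exact: near_eq_differentiable (open_near oU Ux fg) (df x Ux).
apply: IH (Cf v) => x Ux.
by rewrite (near_eq_diff (open_near oU Ux fg) (df x Ux)).
Qed.

Lemma Ck_sub V W k (U U' : set V) (f : V -> W) :
  U' `<=` U -> Ck k U f -> Ck k U' f.
Proof.
move=> UU'; elim: k f => [|k IH] f /=; first by move=> cf x /UU'; exact: cf.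
by move=> [df Cf]; split=> [x /UU'|v]; [exact: df|exact: IH].
Qed.

Lemma CkW V W k (U : set V) (f : V -> W) : Ck k.+1 U f -> Ck k U f.
Proof.
elim: k f => [|k IH] f [df Cf].
  by move=> x Ux; apply: differentiable_continuous; exact: df.
by split=> // v; apply: IH; exact: Cf.
Qed.

Lemma Ck_cst V W k (U : set V) (w : W) : Ck k U (fun=> w).
Proof.
elim: k w => [|k IH] w /=; first by move=> x _; exact: cst_continuous.
split=> [x _|v]; first exact: differentiable_cst.
have -> : (fun x => 'd (fun=> w : W) x v) = (fun=> 0 : W) :> (V -> W).
  by apply/funext => x; rewrite diff_cst.
exact: IH.
Qed.

Lemma CkD V W k (U : set V) (f g : V -> W) : open U ->
  Ck k U f -> Ck k U g -> Ck k U (fun x => f x + g x).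
Proof.
move=> oU; elim: k f g => [|k IH] f g /=.
  by move=> cf cg x Ux; apply: cvgD; [exact: cf|exact: cg].
move=> [df Cf] [dg Cg]; split=> [x Ux|v].
  exact: differentiableD (df x Ux) (dg x Ux).
apply: Ck_ext (IH _ _ (Cf v) (Cg v)) => // x Ux.
exact/esym/(congr1 (@^~ v) (diffD (df x Ux) (dg x Ux))).
Qed.

Lemma Ck_sum V W k (U : set V) n (f : 'I_n -> V -> W) : open U ->
  (forall j, Ck k U (f j)) -> Ck k U (fun x => \sum_j f j x).
Proof.
move=> oU Cf; elim: (index_enum _) => [|j s IH].
  by under eq_fun do rewrite big_nil; exact: Ck_cst.
by under eq_fun do rewrite big_cons; exact: CkD.
Qed.

Lemma Ck_scale V W k (U : set V) (a : V -> R) (f : V -> W) : open U ->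
  Ck k U a -> Ck k U f -> Ck k U (fun x => a x *: f x).
Proof.
move=> oU; elim: k a f => [|k IH] a f.
  by move=> ca cf x Ux; apply: cvgZ; [exact: ca|exact: cf].
move=> Ca Cf; have [da Ca'] := Ca; have [df Cf'] := Cf; split=> [x Ux|v].
  by have [] := is_diff_scale (da x Ux) (df x Ux).
have := CkD oU (IH _ _ (Ca' v) (CkW Cf)) (IH _ _ (CkW Ca) (Cf' v)).
apply: Ck_ext => // x Ux; have [_ ->//] := is_diff_scale (da x Ux) (df x Ux).
Qed.

Lemma Ck_linear V W Z k (U : set V) (L : {linear W -> Z}) (f : V -> W) :
  open U -> continuous L -> Ck k U f -> Ck k U (fun x => L (f x)).
Proof.
move=> oU cL; elim: k f => [|k IH] f.
  by move=> cf x Ux; apply: continuous_comp; [exact: cf|exact: cL].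
move=> [df Cf]; have dL w : differentiable L w by exact: linear_differentiable.
split=> [x Ux|v]; first exact: differentiable_comp (df x Ux) (dL _).
apply: Ck_ext (IH _ (Cf v)) => // x Ux.
by rewrite (diff_comp (df x Ux) (dL _)) /= diff_lin.
Qed.

Lemma coord_is_linear m (j : 'I_m) :
  scalar (fun w : 'rV[R]_m => w 0 j).
Proof. by move=> a u v; rewrite !mxE. Qed.

Lemma Ck_coord V m k (U : set V) (f : V -> 'rV[R]_m) j : open U ->
  Ck k U f -> Ck k U (fun x => f x 0 j).
Proof.
move=> oU Cf.
pose Bm := GRing.isLinear.Build _ _ _ _ _ (@coord_is_linear m j).
pose L : {linear 'rV[R]_m -> R} := HB.pack (fun w : 'rV[R]_m => w 0 j) Bm.
by apply: (@Ck_linear _ _ _ _ _ L) => //; exact: coord_continuous.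
Qed.

(** In [d(g o f)(x) v = dg(f x)(df(x) v)] the direction depends on [x].  The
middle space has a finite basis [e_j], so this is the sum of the
[(df(x) v)_j dg(f x) e_j], to which the induction hypothesis applies. *)
Lemma Ck_comp V W m k (U : set V) (U' : set 'rV[R]_m)
    (f : V -> 'rV[R]_m) (g : 'rV[R]_m -> W) : open U -> open U' ->
  (forall x, U x -> U' (f x)) -> Ck k U f -> Ck k U' g ->
  Ck k U (g \o f).
Proof.
move=> oU oU' fU; elim: k f g fU => [|k IH] f g fU.
  move=> cf cg x Ux; apply: continuous_comp; first exact: cf.
  by apply: cg; exact: fU.
move=> Cf [dg Cg]; have [df Cf'] := Cf; split=> [x Ux|v].
  by apply: differentiable_comp; [exact: df|exact/dg/fU].
apply: (@Ck_ext _ _ _ _ (fun x => \sum_j ('d f x v) 0 j *: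
           (fun y => 'd g y (delta_mx 0 j)) (f x))) => //.
  move=> x Ux; rewrite (diff_comp (df x Ux) (dg _ (fU x Ux))) /=.
  rewrite [in RHS](row_sum_delta ('d f x v)) linear_sum /=.
  by apply: eq_bigr => j _; rewrite linearZ.
apply: Ck_sum => // j; apply: Ck_scale => //.
  exact: Ck_coord (Cf' v).
exact: (IH _ _ fU (CkW Cf) (Cg _)).
Qed.

Lemma Ck_inv V k (U : set V) (f : V -> R) : open U ->
  (forall x, U x -> f x != 0) -> Ck k U f -> Ck k U (fun x => (f x)^-1).
Proof.
move=> oU f0; elim: k => [|k IH].
  by move=> cf x Ux; apply: cvgV; [exact: f0|exact: cf].
move=> Cf; have [df Cf'] := Cf; have If := IH (CkW Cf).
split=> [x Ux|v]; first exact: differentiableV (df x Ux) (f0 x Ux).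
have := Ck_scale oU (Ck_scale oU (@Ck_cst V R k U (-1)) (Ck_scale oU If If)) (Cf' v).
apply: Ck_ext => // x Ux.
apply: etrans (esym (congr1 (@^~ v) (diffV (df x Ux) (f0 x Ux)))).
congr (_ * _).
rewrite [LHS]mulN1r; congr (- _).
by rewrite -[LHS]/((f x)^-1 * (f x)^-1) -invfM.
Qed.

End CkCalculus.

Section SmoothOn.
Variable R : realType.

(** As for composition, the point and the direction may both vary because the
direction can be expanded in a finite basis. *)
Lemma smooth_on_diff (V W : normedModType R) m (U : set V) (U' : set 'rV[R]_m)
    (f : 'rV[R]_m -> W) (a w : V -> 'rV[R]_m) :
  open U -> open U' -> (forall x, U x -> U' (a x)) ->
  smooth_on U' f -> smooth_on U a -> smooth_on U w ->
  smooth_on U (fun x => 'd f (a x) (w x)).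
Proof.
move=> oU oU' aU sf sa sw k.
apply: (@Ck_ext _ _ _ _ _ (fun x => \sum_j w x 0 j *:
           (fun y => 'd f y (delta_mx 0 j)) (a x))) => //.
  move=> x Ux; rewrite [in RHS](row_sum_delta (w x)) linear_sum /=.
  by apply: eq_bigr => j _; rewrite linearZ.
apply: Ck_sum => // j; apply: Ck_scale => //; first exact: Ck_coord.
apply: (@Ck_comp _ _ _ _ _ _ _ _ (fun y => 'd f y _) oU oU' aU (sa k)).
exact: (proj2 (sf k.+1)).
Qed.

End SmoothOn.

(** * Charts and coordinate vector fields *)

Section Charts.
Variables (R : realType) (n : nat) (M : manifold R n).
Implicit Types (p q r s : M) (U : set M).
Local Notation dom p := (cdom (chart_at p)).
Local Notation inv p := (cinv (chart_at p)).

Lemma dom_open p : open (dom p).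
Proof. exact: cdom_open. Qed.

Lemma chartK p q : dom p q -> inv p (chart_at p q) = q.
Proof. by move=> pq; apply: cmapK; rewrite inE. Qed.

Lemma near_cinv p q (P : M -> Prop) : dom p q ->
  (\forall s \near q, P s) -> \forall x \near chart_at p q, P (inv p x).
Proof.
move=> pq Pq; apply: (@cinv_continuous _ _ _ (chart_at p)); last by rewrite chartK.
by rewrite inE; exists q.
Qed.

Lemma near_chart_img p q U : dom p q -> (\forall s \near q, U s) ->
  \forall x \near chart_at p q, (chart_at p @` (dom p `&` U)) x.
Proof.
move=> pq Uq; have := near_cinv pq Uq.
have : \forall x \near chart_at p q, (chart_at p @` dom p) x.
  by apply: open_nbhs_nbhs; split; [exact: cimg_open|exists q].
apply: filterS2 => _ [s ps <-]; rewrite chartK// => Us.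
by exists s.
Qed.

Lemma open_chart_img p U : open U -> open (chart_at p @` (dom p `&` U)).
Proof.
move=> oU; rewrite openE => _ [q [pq Uq] <-].
by apply: near_chart_img => //; exact: open_nbhs_nbhs.
Qed.

Lemma chart_transition_smooth p q :
  smooth_on (chart_at p @` (dom p `&` dom q)) (chart_at q \o inv p).
Proof. exact: chart_at_compat. Qed.

Lemma chart_transition_differentiable p q r : dom p r -> dom q r ->
  differentiable (chart_at q \o inv p) (chart_at p r).
Proof.
by move=> pr qr; have [+ _] := chart_transition_smooth p q 1; apply; exists r.
Qed.

Section ChangeOfChart.
Variable W : normedModType R.
Implicit Types f g : M -> W.

Lemma near_change_chart f p q r : dom p r -> dom q r ->
  \forall x \near chart_at q r,
    ((f \o inv p) \o (chart_at p \o inv q)) x = (f \o inv q) x.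
Proof.
move=> pr qr; apply: (near_cinv (P := fun s => f (inv p (chart_at p s)) = f s)) => //.
have od : nbhs r (dom p) by apply: open_nbhs_nbhs; split; [exact: dom_open|].
by apply: filterS od => s ps; rewrite chartK.
Qed.

Lemma diff_change_chart f p q r v : dom p r -> dom q r ->
  differentiable (f \o inv p) (chart_at p r) ->
  'd (f \o inv q) (chart_at q r) v =
  'd (f \o inv p) (chart_at p r) ('d (chart_at p \o inv q) (chart_at q r) v).
Proof.
move=> pr qr df.
have dt : differentiable (chart_at p \o inv q) (chart_at q r).
  exact: chart_transition_differentiable.
have df' : differentiable (f \o inv p) ((chart_at p \o inv q) (chart_at q r)).
  by rewrite /= chartK.
have dc := differentiable_comp dt df'.
apply: etrans (esym (congr1 (@^~ v) (near_eq_diff (near_change_chart f pr qr) dc))) _.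
by apply: etrans (congr1 (@^~ v) (diff_comp dt df')) _; rewrite /= chartK.
Qed.

Lemma der_chart f p q v : dom p q ->
  differentiable (f \o inv p) (chart_at p q) ->
  der f q v = 'd (f \o inv p) (chart_at p q) (der (chart_at p) q v).
Proof. by move=> pq df; apply: diff_change_chart => //; exact: mem_chart_at. Qed.

End ChangeOfChart.

Lemma near_chart_inv p q : dom p q ->
  \forall x \near chart_at p q, id x = (chart_at p \o inv p) x.
Proof.
move=> pq; have : \forall x \near chart_at p q, (chart_at p @` dom p) x.
  by apply: open_nbhs_nbhs; split; [exact: cimg_open|exists q].
by apply: filterS => _ [s ps <-] /=; rewrite chartK.
Qed.

Lemma diff_chart_self p q v : dom p q ->
  'd (chart_at p \o inv p) (chart_at p q) v = v.
Proof.
move=> pq; have di : is_diff (chart_at p q) (id : 'rV[R]_n -> 'rV[R]_n) id.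
  exact: is_diff_id.
have E := near_eq_diff (near_chart_inv pq) (@ex_diff _ _ _ _ _ _ _ di).
exact: etrans (esym (congr1 (@^~ v) E)) (congr1 (@^~ v) (@diff_val _ _ _ _ _ _ _ di)).
Qed.

Lemma der_chart_self p v : der (chart_at p) p v = v.
Proof. by apply: diff_chart_self; exact: mem_chart_at. Qed.

(** The transition maps between two charts are inverse to each other near [r],
and so are their differentials. *)
Lemma diff_transitionK p q r v : dom p r -> dom q r ->
  'd (chart_at p \o inv q) (chart_at q r)
    ('d (chart_at q \o inv p) (chart_at p r) v) = v.
Proof.
move=> pr qr; have dt := chart_transition_differentiable qr pr.
apply: etrans (esym (diff_change_chart v qr pr dt)) _.
exact: diff_chart_self.
Qed.

(** The coordinate vector field of the chart at [p] with constant components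
[w].  It serves as a local frame and to extend a tangent vector at [p]. *)
Definition cfield p (w : 'rV[R]_n) q : 'rV[R]_n :=
  'd (chart_at q \o inv p) (chart_at p q) w.

Lemma der_cfield p q w : dom p q -> der (chart_at p) q (cfield p w q) = w.
Proof. by move=> pq; apply: diff_transitionK => //; exact: mem_chart_at. Qed.

Lemma cfield_der p q v : dom p q -> cfield p (der (chart_at p) q v) q = v.
Proof. by move=> pq; apply: diff_transitionK => //; exact: mem_chart_at. Qed.

Lemma cfield_self p w : cfield p w p = w.
Proof. exact: der_chart_self. Qed.

End Charts.

(** * Smooth functions on a manifold *)

Section SmoothNear.
Variables (R : realType) (n : nat) (M : manifold R n).
Implicit Types (p q r s : M) (U : set M) (W : normedModType R).
Local Notation dom p := (cdom (chart_at p)).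
Local Notation inv p := (cinv (chart_at p)).

Lemma smooth_fct_on_sub W U U' (f : M -> W) :
  U' `<=` U -> smooth_fct_on U f -> smooth_fct_on U' f.
Proof.
move=> UU' sf q k; apply: Ck_sub (sf q k).
by apply: image_subset; apply: setIS.
Qed.

Lemma smooth_fct_on_ext W U (f g : M -> W) : open U ->
  (forall q, U q -> f q = g q) -> smooth_fct_on U f -> smooth_fct_on U g.
Proof.
move=> oU fg sf q k; apply: Ck_ext (sf q k); first exact: open_chart_img.
by move=> _ [s [qs Us] <-] /=; rewrite chartK//; exact: fg.
Qed.

Lemma open_nbhsI p U U' : open_nbhs p U -> open_nbhs p U' ->
  open_nbhs p (U `&` U').
Proof. by move=> [oU pU] [oU' pU']; split; [exact: openI|]. Qed.

Lemma near_open_nbhs p (P : M -> Prop) : (\forall q \near p, P q) ->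
  exists2 U, open_nbhs p U & forall q, U q -> P q.
Proof. by rewrite -[X in X -> _]/(nbhs p P) nbhsE => -[U oU UP]; exists U. Qed.

Lemma smooth_fct_near_ext W p (f g : M -> W) :
  (\forall q \near p, f q = g q) -> smooth_fct_near p f -> smooth_fct_near p g.
Proof.
move=> /near_open_nbhs[U oU fg] [U' oU' sf].
have oUU' := open_nbhsI oU oU'; exists (U `&` U') => //.
apply: (@smooth_fct_on_ext _ _ f); [by case: oUU'|by move=> q [/fg]|].
by apply: smooth_fct_on_sub sf => q [].
Qed.

(** A single chart suffices to test smoothness, since the transition maps are
smooth. *)
Lemma smooth_fct_on_chart W p U (f : M -> W) : open U -> U `<=` dom p ->
  smooth_on (chart_at p @` U) (f \o inv p) -> smooth_fct_on U f.
Proof.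
move=> oU Up sf q k; have oi := @open_chart_img _ _ M q U oU.
have oU' : open (chart_at p @` U).
  by rewrite -(setIidr Up); exact: open_chart_img.
apply: (@Ck_ext _ _ _ _ _ ((f \o inv p) \o (chart_at p \o inv q))) => //.
  by move=> _ [s [qs Us] <-] /=; rewrite chartK// chartK//; exact: Up.
apply: (Ck_comp oi oU') => //.
  by move=> _ [s [qs Us] <-] /=; rewrite chartK//; exists s.
apply: Ck_sub (@chart_transition_smooth _ _ _ q p k).
by apply: image_subset; apply: setIS.
Qed.

Lemma smooth_fct_near_diff W p (f : M -> W) : smooth_fct_near p f ->
  \forall q \near p, forall r, dom r q ->
    differentiable (f \o inv r) (chart_at r q).
Proof.
move=> [U [oU pU] sf]; apply: (open_near oU pU) => q Uq r rq.
by have [+ _] := sf r 1; apply; exists q.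
Qed.

Lemma smooth_fct_near_diff_at W p (f : M -> W) : smooth_fct_near p f ->
    differentiable (f \o inv p) (chart_at p p).
Proof. by move=> /smooth_fct_near_diff/nbhs_singleton; apply; exact: mem_chart_at. Qed.

Lemma smooth_fct_near_near W p (f : M -> W) : smooth_fct_near p f ->
  \forall q \near p, smooth_fct_near q f.
Proof.
by move=> [U [oU pU] sf]; apply: (open_near oU pU) => q Uq; exists U.
Qed.

Lemma smooth_fct_near_cst W p (w : W) : smooth_fct_near p (fun=> w : W).
Proof.
by exists setT => [|q k]; [split => //; exact: openT|exact: Ck_cst].
Qed.

Lemma smooth_fct_nearD W p (f g : M -> W) : smooth_fct_near p f ->
  smooth_fct_near p g -> smooth_fct_near p (fun q => f q + g q).
Proof.
move=> [U oU sf] [U' oU' sg].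
have oUU' := open_nbhsI oU oU'; exists (U `&` U') => // q k.
apply: CkD; first by apply: open_chart_img; case: oUU'.
  by apply: (@smooth_fct_on_sub _ U); [move=> s []|].
by apply: (@smooth_fct_on_sub _ U'); [move=> s []|].
Qed.

Lemma smooth_fct_near_scale W p (a : M -> R) (f : M -> W) : smooth_fct_near p a ->
  smooth_fct_near p f -> smooth_fct_near p (fun q => a q *: f q).
Proof.
move=> [U oU sf] [U' oU' sg].
have oUU' := open_nbhsI oU oU'; exists (U `&` U') => // q k.
apply: (@Ck_scale _ _ _ _ _ (a \o inv q)).
- by apply: open_chart_img; case: oUU'.
- by apply: (@smooth_fct_on_sub _ U); [move=> s []|].
- by apply: (@smooth_fct_on_sub _ U'); [move=> s []|].
Qed.

Lemma smooth_fct_near_sum W p (I : Type) (s : seq I) (f : I -> M -> W) :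
  (forall j, smooth_fct_near p (f j)) ->
  smooth_fct_near p (fun q => \sum_(j <- s) f j q).
Proof.
move=> sf; elim: s => [|j s IH].
  by under eq_fun do rewrite big_nil; exact: smooth_fct_near_cst.
by under eq_fun do rewrite big_cons; exact: smooth_fct_nearD.
Qed.

Lemma smooth_fct_near_prod p (I : Type) (s : seq I) (f : I -> M -> R) :
  (forall j, smooth_fct_near p (f j)) ->
  smooth_fct_near p (fun q => \prod_(j <- s) f j q).
Proof.
move=> sf; elim: s => [|j s IH].
  by under eq_fun do rewrite big_nil; exact: smooth_fct_near_cst.
by under eq_fun do rewrite big_cons; exact: (smooth_fct_near_scale (sf j) IH).
Qed.

Lemma smooth_fct_near_inv p (f : M -> R) : smooth_fct_near p f ->
  (\forall q \near p, f q != 0) -> smooth_fct_near p (fun q => (f q)^-1).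
Proof.
move=> [U oU sf] /near_open_nbhs[U' oU' f0].
have oUU' := open_nbhsI oU oU'; exists (U `&` U') => // q k.
apply: (@Ck_inv _ _ _ _ (f \o inv q)).
- by apply: open_chart_img; case: oUU'.
- by move=> _ [s [qs [_ /f0]] + <-] /=; rewrite chartK.
- by apply: (@smooth_fct_on_sub _ U); [move=> s []|].
Qed.

Lemma smooth_fct_near_coord m p (f : M -> 'rV[R]_m) j : smooth_fct_near p f ->
  smooth_fct_near p (fun q => f q 0 j).
Proof.
move=> [U oU sf]; exists U => // q k.
apply: (@Ck_coord _ _ _ _ _ (f \o inv q)); last exact: sf.
by apply: open_chart_img; case: oU.
Qed.

Section Der.
Variable W : normedModType R.
Implicit Types f g : M -> W.

Lemma der_linear f p : linear (der f p).
Proof. by move=> a u v; rewrite /der linearP. Qed.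

Lemma near_eq_der f g p v : smooth_fct_near p f ->
  (\forall q \near p, f q = g q) -> der f p v = der g p v.
Proof.
move=> /smooth_fct_near_diff_at df fg.
have H := near_cinv (mem_chart_at p) fg.
by have := congr1 (@^~ v) (near_eq_diff H df).
Qed.

Lemma der_cst (w : W) p v : der (fun=> w : W) p v = 0.
Proof. by rewrite /der (_ : _ \o _ = cst w)// diff_cst. Qed.

Lemma derD f g p v : smooth_fct_near p f -> smooth_fct_near p g ->
  der (fun q => f q + g q) p v = der f p v + der g p v.
Proof.
move=> /smooth_fct_near_diff_at df /smooth_fct_near_diff_at dg.
by have := congr1 (@^~ v) (diffD df dg).
Qed.

Lemma der_scale (a : M -> R) f p v :
  smooth_fct_near p a -> smooth_fct_near p f ->
  der (fun q => a q *: f q) p v = der a p v *: f p + a p *: der f p v.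
Proof.
move=> /smooth_fct_near_diff_at df /smooth_fct_near_diff_at dg.
have [_ E] := is_diff_scale df dg.
have := congr1 (@^~ v) E; rewrite /der /= chartK//; exact: mem_chart_at.
Qed.

Lemma der_coord m (f : M -> 'rV[R]_m) p v j : smooth_fct_near p f ->
  der (fun q => f q 0 j) p v = der f p v 0 j.
Proof.
move=> /smooth_fct_near_diff_at df.
pose Bm := GRing.isLinear.Build _ _ _ _ _ (@coord_is_linear R m j).
pose L : {linear 'rV[R]_m -> R} := HB.pack (fun w : 'rV[R]_m => w 0 j) Bm.
have cL : continuous L by exact: coord_continuous.
have dL w : differentiable L w by exact: linear_differentiable.
have := congr1 (@^~ v) (diff_comp df (dL _)).
by rewrite (diff_lin _ cL).
Qed.

End Der.

End SmoothNear.

(** * Smooth maps and fields along them *)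

Section Maps.
Variables (R : realType) (n k : nat) (M : manifold R n) (N : manifold R k).
Variable i : M -> N.
Hypothesis smi : smooth_map i.
Implicit Types (p q : M) (W : normedModType R).
Local Notation dom p := (cdom (chart_at p)).
Local Notation inv p := (cinv (chart_at p)).

Lemma open_preimage_dom (r : N) : open (i @^-1` dom r).
Proof. by have [ci _] := smi; move/continuousP: ci; apply; exact: dom_open. Qed.

Lemma smooth_fct_near_map p (r : N) : dom r (i p) -> smooth_fct_near p (chart_at r \o i).
Proof.
move=> rp; exists (i @^-1` dom r); last by have [_] := smi; exact.
by split=> //; exact: open_preimage_dom.
Qed.

Lemma smooth_fct_near_comp W p (G : N -> W) :
  smooth_fct_near (i p) G -> smooth_fct_near p (G \o i).
Proof.
move=> [U [oU Up] sG]; set ip := i p; have [ci sci] := smi.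
have oV : open (i @^-1` (dom ip `&` U)).
  by move/continuousP: ci; apply; apply: openI => //; exact: dom_open.
exists (i @^-1` (dom ip `&` U)).
  by split=> //; split=> //; exact: mem_chart_at.
move=> q j; have oq : open (chart_at q @` (dom q `&` i @^-1` (dom ip `&` U))).
  exact: open_chart_img.
apply: (@Ck_ext _ _ _ _ _ ((G \o inv ip) \o (chart_at ip \o i \o inv q))) => //.
  by move=> _ [s [qs [/= ips Us]] <-] /=; rewrite (chartK qs) (chartK ips).
apply: (@Ck_comp _ _ _ _ _ _ (chart_at ip @` (dom ip `&` U))) => //.
- exact: open_chart_img.
- by move=> _ [s [qs [/= ips Us]] <-] /=; rewrite (chartK qs); exists (i s).
- apply: Ck_sub (sci ip q j) => _ [s [qs [/= ips Us]] <-].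
  by exists s.
- exact: sG.
Qed.

(** Near [p] the map [G o i], read in a chart, factors through the chart at
[i p]; what remains is the chain rule in coordinates. *)
Lemma der_comp W p (G : N -> W) v :
  differentiable (G \o inv (i p)) (chart_at (i p) (i p)) ->
  der (G \o i) p v = der G (i p) (tmap i p v).
Proof.
move=> dG; have pp := mem_chart_at p; have ipp := mem_chart_at (i p).
have ds : differentiable ((chart_at (i p) \o i) \o inv p) (chart_at p p).
  exact: smooth_fct_near_diff_at (smooth_fct_near_map ipp).
have dG' : differentiable (G \o inv (i p))
    (((chart_at (i p) \o i) \o inv p) (chart_at p p)).
  by rewrite /= chartK.
have E : \forall x \near chart_at p p,
   ((G \o inv (i p)) \o ((chart_at (i p) \o i) \o inv p)) x = ((G \o i) \o inv p) x.
  apply: (near_cinv (P := fun s => G (inv (i p) (chart_at (i p) (i s))) = G (i s))) => //.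
  by apply: (open_near (open_preimage_dom (i p))) => // s ps; rewrite chartK.
have E1 := congr1 (@^~ v) (near_eq_diff E (differentiable_comp ds dG')).
apply: etrans (esym E1) _; apply: etrans (congr1 (@^~ v) (diff_comp ds dG')) _.
by rewrite /= chartK.
Qed.

Lemma der_chart_map p (r : N) v : dom r (i p) ->
  der (chart_at r \o i) p v = der (chart_at r) (i p) (tmap i p v).
Proof.
move=> rp; apply: der_comp; apply: chart_transition_differentiable => //.
exact: mem_chart_at.
Qed.

Lemma tmap_linear p : linear (tmap i p).
Proof. exact: der_linear. Qed.

(** The components in the other charts of the target are obtained by applying
the differentials of the transition maps, which depend smoothly on the
point. *)
Lemma field_along_nearP p (Z : M -> 'rV[R]_k) :
  field_along_near i p Z <->
  smooth_fct_near p (fun q => der (chart_at (i p)) (i q) (Z q)).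
Proof.
set r := i p; have rr := mem_chart_at r; split.
  move=> [U [oU Up] fU]; exists (U `&` i @^-1` dom r); last exact: fU.
  by split; [apply: openI => //; exact: open_preimage_dom|].
move=> [U0 [oU0 Up0] sU0].
have oU : open (U0 `&` i @^-1` dom r).
  by apply: openI => //; exact: open_preimage_dom.
set U := U0 `&` i @^-1` dom r in oU.
have sU : smooth_fct_on U (fun q => der (chart_at r) (i q) (Z q)).
  by apply: smooth_fct_on_sub sU0 => q [].
have pU : open_nbhs p U by split; [|split].
exists U; first exact: pU.
move=> s; have oV : open (U `&` i @^-1` dom s).
  by apply: openI => //; exact: open_preimage_dom.
apply: (@smooth_fct_on_ext _ _ _ _ _ (fun q =>
   'd (chart_at s \o inv r) (chart_at r (i q)) (der (chart_at r) (i q) (Z q)))) => //.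
  move=> q [[_ rq] sq]; rewrite -der_chart//.
  exact: chart_transition_differentiable.
move=> q; have oq : open (chart_at q @` (dom q `&` (U `&` i @^-1` dom s))).
  exact: open_chart_img.
apply: (@smooth_on_diff _ _ _ _ _ (chart_at r @` (dom r `&` dom s))
  (chart_at s \o inv r) (chart_at r \o i \o inv q)
  (fun x => der (chart_at r) (i (inv q x)) (Z (inv q x)))) => //.
- by apply: open_chart_img; exact: dom_open.
- by move=> _ [t [qt [[_ rt] st]] <-] /=; rewrite (chartK qt); exists (i t).
- exact: chart_transition_smooth.
- have [_ sci] := smi; move=> j; apply: Ck_sub (sci r q j).
  by move=> _ [t [qt [[_ rt] st]] <-]; exists t.
- move=> j; apply: Ck_sub (sU q j).
  by move=> _ [t [qt [tU st]] <-]; exists t.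
Qed.

Lemma near_preimage_dom p : \forall q \near p, dom (i p) (i q).
Proof.
by apply: (open_near (open_preimage_dom (i p))) => //; exact: mem_chart_at.
Qed.

Lemma field_along_near_ext p (Z1 Z2 : M -> 'rV[R]_k) :
  (\forall q \near p, Z1 q = Z2 q) -> field_along_near i p Z1 ->
  field_along_near i p Z2.
Proof.
move=> E /field_along_nearP sZ; apply/field_along_nearP.
by apply: smooth_fct_near_ext sZ; apply: filterS E => q ->.
Qed.

Lemma field_along_nearD p (Z1 Z2 : M -> 'rV[R]_k) :
  field_along_near i p Z1 -> field_along_near i p Z2 ->
  field_along_near i p (fun q => Z1 q + Z2 q).
Proof.
move=> /field_along_nearP s1 /field_along_nearP s2; apply/field_along_nearP.
apply: smooth_fct_near_ext (smooth_fct_nearD s1 s2); apply: nearW => q.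
by rewrite /der linearD.
Qed.

Lemma field_along_near_scale p (a : M -> R) (Z : M -> 'rV[R]_k) :
  smooth_fct_near p a -> field_along_near i p Z ->
  field_along_near i p (fun q => a q *: Z q).
Proof.
move=> sa /field_along_nearP s2; apply/field_along_nearP.
apply: smooth_fct_near_ext (smooth_fct_near_scale sa s2); apply: nearW => q.
by rewrite /der linearZ.
Qed.

Lemma field_along_near0 p : field_along_near i p (fun=> 0).
Proof.
apply/field_along_nearP; apply: smooth_fct_near_ext (smooth_fct_near_cst p 0).
by apply: nearW => q; rewrite /der linear0.
Qed.

Lemma field_along_near_sum p (I : Type) (s : seq I) (Z : I -> M -> 'rV[R]_k) :
  (forall j, field_along_near i p (Z j)) ->
  field_along_near i p (fun q => \sum_(j <- s) Z j q).
Proof.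
move=> sf; elim: s => [|j s IH].
  by under eq_fun do rewrite big_nil; exact: field_along_near0.
by under eq_fun do rewrite big_cons; exact: field_along_nearD.
Qed.

End Maps.

Section Fields.
Variables (R : realType) (n : nat) (M : manifold R n).
Implicit Types (p q : M) (W : normedModType R).
Local Notation dom p := (cdom (chart_at p)).
Local Notation inv p := (cinv (chart_at p)).

Lemma smooth_map_id : smooth_map (idfun : M -> M).
Proof.
split=> [x|q r j]; first exact: cvg_id.
by apply: Ck_sub (@chart_transition_smooth _ _ M r q j).
Qed.

Lemma vfield_nearP p (X : M -> 'rV[R]_n) :
  vfield_near p X <-> smooth_fct_near p (fun q => der (chart_at p) q (X q)).
Proof. exact: (field_along_nearP smooth_map_id). Qed.

Lemma vfield_near0 p : vfield_near p (fun=> 0).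
Proof. exact: (field_along_near0 smooth_map_id). Qed.

Lemma near_dom p : \forall q \near p, dom p q.
Proof. exact: (near_preimage_dom smooth_map_id). Qed.

Lemma vfield_near_cfield p w : vfield_near p (cfield p w).
Proof.
apply/vfield_nearP; apply: smooth_fct_near_ext (smooth_fct_near_cst p w).
by apply: filterS (near_dom p) => q pq; rewrite der_cfield.
Qed.

Lemma vfield_near_vfield p (X : M -> 'rV[R]_n) : vfield X -> vfield_near p X.
Proof. by exists setT => //; split => //; exact: openT. Qed.

(** In the chart at [p] the derivative is [d(f o chart^-1)] applied to the
components of [X], all of which are smooth. *)
Lemma smooth_fct_near_der W p (f : M -> W) (X : M -> 'rV[R]_n) :
  smooth_fct_near p f -> vfield_near p X ->
  smooth_fct_near p (fun q => der f q (X q)).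
Proof.
move=> sf /vfield_nearP sX.
have [U0 [oU0 pU0] sf0] := sf; have [U1 [oU1 pU1] sX1] := sX.
pose U := U0 `&` U1 `&` dom p.
have oU : open U by apply: openI; [exact: openI|exact: dom_open].
exists U; first by split=> //; split => //; exact: mem_chart_at.
have oI : open (chart_at p @` U).
  rewrite (_ : U = dom p `&` (U0 `&` U1)); last by rewrite /U setIC.
  by apply: open_chart_img; exact: openI.
apply: (@smooth_fct_on_chart _ _ _ _ p) => //; first by move=> q [].
have : smooth_on (chart_at p @` U)
    (fun x => 'd (f \o inv p) x (der (chart_at p) (inv p x) (X (inv p x)))).
  apply: (@smooth_on_diff _ _ _ _ _ (chart_at p @` (dom p `&` U0)) (f \o inv p) id) => //.
  - exact: open_chart_img.
  - by move=> _ [q [[? ?] ?] <-]; exists q.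
  - elim=> [|j _]; first by move=> x _; exact: cvg_id.
    split=> [x _|v]; first by apply: ex_diff; exact: is_diff_id.
    have -> : (fun x => 'd id x v) = (fun=> v) :> ('rV[R]_n -> 'rV[R]_n).
      by apply/funext => x; have [_ ->] := is_diff_id x.
    exact: Ck_cst.
  - move=> j; apply: Ck_sub (sX1 p j).
    by move=> _ [q [[? ?] ?] <-]; exists q.
move=> s j; apply: Ck_ext (s j) => //.
move=> _ [q [[U0q _] pq] <-] /=; rewrite chartK// -der_chart//.
by have [+ _] := sf0 p 1; apply; exists q.
Qed.

End Fields.

Section Along.
Variables (R : realType) (n k : nat) (M : manifold R n) (N : manifold R k).
Variable i : M -> N.
Hypothesis smi : smooth_map i.
Implicit Types (p q : M).
Local Notation dom p := (cdom (chart_at p)).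

Lemma field_along_near_pull p (Y : N -> 'rV[R]_k) :
  vfield_near (i p) Y -> field_along_near i p (Y \o i).
Proof.
move=> /vfield_nearP sY; apply/(field_along_nearP smi).
exact: (smooth_fct_near_comp smi sY).
Qed.

Lemma field_along_near_push p (X : M -> 'rV[R]_n) :
  vfield_near p X -> field_along_near i p (fun q => tmap i q (X q)).
Proof.
move=> vX; apply/(field_along_nearP smi).
have s := smooth_fct_near_map smi (mem_chart_at (i p)).
apply: smooth_fct_near_ext (smooth_fct_near_der s vX).
by apply: filterS (near_preimage_dom smi p) => q pq; rewrite der_chart_map.
Qed.

Definition comp_at p (Z : M -> 'rV[R]_k) j q : R :=
  der (chart_at (i p)) (i q) (Z q) 0 j.

Lemma smooth_comp_at p Z j : field_along_near i p Z ->
  smooth_fct_near p (comp_at p Z j).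
Proof. by move=> /(field_along_nearP smi); exact: smooth_fct_near_coord. Qed.

Definition frame_sum p Z q : 'rV[R]_k :=
  \sum_j comp_at p Z j q *: (cfield (i p) (delta_mx 0 j) \o i) q.

Lemma frame_sumE p Z : \forall q \near p, frame_sum p Z q = Z q.
Proof.
apply: filterS (near_preimage_dom smi p) => q pq.
rewrite -[RHS](cfield_der _ pq) [in RHS](row_sum_delta (der _ _ _)).
rewrite /cfield linear_sum /=; apply: eq_bigr => j _.
by rewrite linearZ.
Qed.

(** The restrictions of fields of [N] generate the fields along [i] near [p]
over the smooth functions: [Z] agrees near [p] with its expansion in the
coordinate frame of the chart at [i p]. *)
Lemma field_along_ind p (Q : (M -> 'rV[R]_k) -> Prop) :
  (forall Y, vfield_near (i p) Y -> Q (Y \o i)) ->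
  (forall Z1 Z2, field_along_near i p Z1 -> field_along_near i p Z2 ->
     Q Z1 -> Q Z2 -> Q (fun q => Z1 q + Z2 q)) ->
  (forall (a : M -> R) Z, smooth_fct_near p a -> field_along_near i p Z ->
     Q Z -> Q (fun q => a q *: Z q)) ->
  (forall Z1 Z2, field_along_near i p Z1 -> (\forall q \near p, Z1 q = Z2 q) ->
     Q Z1 -> Q Z2) ->
  forall Z, field_along_near i p Z -> Q Z.
Proof.
move=> Qpull QD Qs Qext Z fZ.
have fE j : field_along_near i p (cfield (i p) (delta_mx 0 j) \o i).
  by apply: field_along_near_pull; exact: vfield_near_cfield.
have ft j : field_along_near i p
    (fun q => comp_at p Z j q *: (cfield (i p) (delta_mx 0 j) \o i) q).
  by apply: (field_along_near_scale smi) => //; exact: smooth_comp_at.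
apply: (Qext _ _ _ (frame_sumE p Z)); first exact: (field_along_near_sum smi).
rewrite /frame_sum; elim: (index_enum _) => [|j s IH].
  under eq_fun do rewrite big_nil; exact: (Qpull (fun=> 0)) (vfield_near0 _).
under eq_fun do rewrite big_cons; apply: QD => //.
  exact: (field_along_near_sum smi).
apply: Qs => //; first exact: smooth_comp_at.
by apply: Qpull; exact: vfield_near_cfield.
Qed.

End Along.

(** * Pulled-back connections *)

Section ConnectionSum.
Variables (R : realType) (n k : nat) (M : manifold R n) (N : manifold R k).
Variable i : M -> N.
Hypothesis smi : smooth_map i.
Variable D : M -> 'rV[R]_n -> (M -> 'rV[R]_k) -> 'rV[R]_k.
Hypothesis cD : is_connection_along i D.

Lemma connection0 p v : D p v (fun=> 0) = 0.
Proof.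
have f0 := field_along_near0 smi p.
have := connectionD cD v f0 f0.
under eq_fun do rewrite addr0.
by move=> /(congr1 (fun w => w - D p v (fun=> 0))); rewrite addrK subrr.
Qed.

Lemma connection_sum p v (a : 'I_k -> M -> R) (Z : 'I_k -> M -> 'rV[R]_k) :
  (forall j, smooth_fct_near p (a j)) -> (forall j, field_along_near i p (Z j)) ->
  D p v (fun q => \sum_j a j q *: Z j q) =
  \sum_j (der (a j) p v *: Z j p + a j p *: D p v (Z j)).
Proof.
move=> sa fZ; have faZ j : field_along_near i p (fun q => a j q *: Z j q).
  exact: (field_along_near_scale smi).
elim: (index_enum _) => [|j s IH].
  by under eq_fun do rewrite big_nil; rewrite big_nil connection0.
under eq_fun do rewrite big_cons.
rewrite big_cons -IH (connectionD cD _ (faZ j)) ?(connection_leibniz cD)//.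
exact: (field_along_near_sum smi).
Qed.

End ConnectionSum.

Section Pullback.
Variables (R : realType) (n k : nat) (M : manifold R n) (N : manifold R k).
Variable i : M -> N.
Hypothesis smi : smooth_map i.
Variable nb : N -> 'rV[R]_k -> (N -> 'rV[R]_k) -> 'rV[R]_k.
Hypothesis cnb : is_connection nb.
Variable D : M -> 'rV[R]_n -> (M -> 'rV[R]_k) -> 'rV[R]_k.
Hypothesis pD : is_pullback_connection i nb D.

(** The Leibniz terms vanish because coordinate fields have constant
components. *)
Lemma connection_cfield_sum (p : N) v w :
  nb p v (cfield p w) = \sum_j w 0 j *: nb p v (cfield p (delta_mx 0 j)).
Proof.
have -> : cfield p w = (fun q => \sum_j w 0 j *: cfield p (delta_mx 0 j) q).
  apply/funext => q; rewrite /cfield [in LHS](row_sum_delta w) linear_sum /=.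
  by apply: eq_bigr => j _; rewrite linearZ.
rewrite (connection_sum (smooth_map_id N) cnb v (a := fun j _ => w 0 j)).
- by apply: eq_bigr => j _; rewrite der_cst scale0r add0r.
- by move=> j; exact: smooth_fct_near_cst.
- by move=> j; exact: vfield_near_cfield.
Qed.

(** The derivative of the components plus a Christoffel term: expand [Z] in the
coordinate frame of the chart at [i p], whose vectors at [i p] are those of the
standard basis. *)
Lemma pullback_connectionE p v Z : field_along_near i p Z ->
  D p v Z = der (fun q => der (chart_at (i p)) (i q) (Z q)) p v
            + nb (i p) (tmap i p v) (cfield (i p) (Z p)).
Proof.
move=> fZ; have [cD Dpull] := pD.
have fE j : field_along_near i p (cfield (i p) (delta_mx 0 j) \o i).
  by apply: (field_along_near_pull smi); exact: vfield_near_cfield.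
have sc j : smooth_fct_near p (comp_at i p Z j) by exact: smooth_comp_at.
have ZE : \forall q \near p, Z q = frame_sum i p Z q.
  by apply: filterS (frame_sumE smi p Z) => q ->.
rewrite (connection_local cD v fZ ZE) /frame_sum (connection_sum smi cD)//.
rewrite big_split /=; congr (_ + _).
  rewrite [RHS](row_sum_delta (der _ p v)); apply: eq_bigr => j _.
  rewrite cfield_self; congr (_ *: _); apply: der_coord.
  by apply/(field_along_nearP smi).
rewrite connection_cfield_sum; apply: eq_bigr => j _.
rewrite /comp_at der_chart_self Dpull//; exact: vfield_near_cfield.
Qed.

End Pullback.

Section CoordinateTorsion.
Variables (R : realType) (n : nat) (M : manifold R n).
Implicit Types p q : M.

(** Symmetry of the Christoffel symbols.  Tested on a coordinate function,
the bracket of two coordinate fields is zero because they have constant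
components. *)
Lemma cfield_torsion_free p v w g nM :
  is_levi_civita (M := M) g nM -> nM p v (cfield p w) = nM p w (cfield p v).
Proof.
move=> lcM; apply/subr0_eq/rowP => j; rewrite [RHS]mxE.
have sc : smooth_fct_near p (chart_at p).
  exact: (smooth_fct_near_map (smooth_map_id M) (mem_chart_at p)).
have sj := smooth_fct_near_coord j sc.
have cst_der w' : der (fun q => der (fun x => chart_at p x 0 j) q (cfield p w' q))
    p =1 (fun=> 0).
  move=> u; rewrite -(der_cst (w' 0 j) p u); apply/esym/near_eq_der.
    exact: smooth_fct_near_cst.
  have := near_dom p; apply: filterS2 (smooth_fct_near_near sc) => q sq pq.
  by rewrite der_coord// der_cfield.
have := levi_civita_torsion_free lcM (vfield_near_cfield p v)
  (vfield_near_cfield p w) sj.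
by rewrite !cfield_self der_coord// der_chart_self !cst_der subrr => ->.
Qed.

End CoordinateTorsion.

Section Torsion.
Variables (R : realType) (n k : nat) (M : manifold R n) (N : manifold R k).
Implicit Types p q : M.
Variable i : M -> N.
Hypothesis smi : smooth_map i.

(** The Christoffel terms of the two derivatives cancel by symmetry.  What
remains is [X (Y f) - Y (X f)], where [f] runs over the components of [i]; since
[nM] is torsion-free, that is the derivative of [f] along
[nM_X Y - nM_Y X]. *)
Lemma pullback_torsion_free gN nb D gM nM p X Y :
  is_levi_civita (M := N) gN nb -> is_pullback_connection i nb D ->
  is_levi_civita (M := M) gM nM -> vfield_near p X -> vfield_near p Y ->
  D p (X p) (fun q => tmap i q (Y q)) - D p (Y p) (fun q => tmap i q (X q)) =
  tmap i p (nM p (X p) Y - nM p (Y p) X).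
Proof.
move=> lcN pD lcM vX vY; have ipp := mem_chart_at (i p).
have sc : smooth_fct_near p (chart_at (i p) \o i) by exact: smooth_fct_near_map.
have derE Z u : vfield_near p Z ->
    der (fun q => der (chart_at (i p)) (i q) (tmap i q (Z q))) p u =
    der (fun q => der (chart_at (i p) \o i) q (Z q)) p u.
  move=> vZ; apply/esym/near_eq_der; first exact: smooth_fct_near_der.
  by apply: filterS (near_preimage_dom smi p) => q pq; rewrite der_chart_map.
have cN := levi_civita_connection lcN.
rewrite !(pullback_connectionE smi cN pD); try exact: field_along_near_push.
rewrite !derE// (cfield_torsion_free _ _ _ lcN) opprD addrACA subrr addr0.
apply/rowP => j; rewrite mxE [in LHS]mxE.
have sj := smooth_fct_near_coord j sc.
have derj Z u : vfield_near p Z ->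
    der (fun q => der (chart_at (i p) \o i) q (Z q)) p u 0 j =
    der (fun q => der (fun x => (chart_at (i p) \o i) x 0 j) q (Z q)) p u.
  move=> vZ; rewrite -der_coord; last exact: smooth_fct_near_der.
  apply: near_eq_der; first by apply: smooth_fct_near_coord; exact: smooth_fct_near_der.
  by apply: filterS (smooth_fct_near_near sc) => q sq; rewrite der_coord.
rewrite !derj// /tmap -(der_coord _ _ sc) (levi_civita_torsion_free lcM vX vY sj).
by [].
Qed.

End Torsion.

(** * The metric on fields along a map *)

Section Metric.
Variables (R : realType) (n k : nat) (M : manifold R n) (N : manifold R k).
Variable g : N -> 'rV[R]_k -> 'rV[R]_k -> R.
Hypothesis gN : is_riemannian_metric g.
Implicit Types (p q : M).

Lemma metricDl (r : N) u v w : g r (u + v) w = g r u w + g r v w.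
Proof. by have := metric_linear gN r w 1 u v; rewrite scale1r mul1r. Qed.

Lemma metric0l (r : N) w : g r 0 w = 0.
Proof.
have := metricDl r 0 0 w; rewrite addr0 => /(congr1 (fun x => x - g r 0 w)).
by rewrite addrK subrr.
Qed.

Lemma metricZl (r : N) a v w : g r (a *: v) w = a * g r v w.
Proof. by have := metric_linear gN r w a v 0; rewrite addr0 metric0l addr0. Qed.

Lemma metricBl (r : N) u v w : g r (u - v) w = g r u w - g r v w.
Proof. by rewrite metricDl -scaleN1r metricZl mulN1r. Qed.

Lemma metricDr (r : N) u v w : g r w (u + v) = g r w u + g r w v.
Proof. by rewrite ![g r w _](Defs.metric_sym gN) metricDl. Qed.

Lemma metricZr (r : N) a v w : g r w (a *: v) = a * g r w v.
Proof. by rewrite ![g r w _](Defs.metric_sym gN) metricZl. Qed.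

Lemma metric_suml (r : N) m (a : 'I_m -> R) (u : 'I_m -> 'rV[R]_k) w :
  g r (\sum_j a j *: u j) w = \sum_j a j * g r (u j) w.
Proof.
elim: (index_enum _) => [|j s IH]; first by rewrite !big_nil metric0l.
by rewrite !big_cons metricDl metricZl IH.
Qed.

Lemma metric_eq0 (r : N) v : g r v v = 0 -> v = 0.
Proof.
move=> gv; apply/eqP; apply: contraPT gv => /(metric_pos gN r) gv.
by apply/eqP; rewrite gt_eqF.
Qed.

Lemma smooth_metric_vfield (r : N) Y1 Y2 : vfield_near r Y1 -> vfield_near r Y2 ->
  smooth_fct_near r (fun s => g s (Y1 s) (Y2 s)).
Proof.
move=> [U1 o1 y1] [U2 o2 y2].
have oU := open_nbhsI o1 o2; exists (U1 `&` U2) => //.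
apply: (metric_smooth gN); first by case: oU.
  by move=> q; apply: smooth_fct_on_sub (y1 q) => s [[]].
by move=> q; apply: smooth_fct_on_sub (y2 q) => s [[]].
Qed.

Variable i : M -> N.
Hypothesis smi : smooth_map i.

Lemma smooth_metric_along p Z1 Z2 :
  field_along_near i p Z1 -> field_along_near i p Z2 ->
  smooth_fct_near p (fun q => g (i q) (Z1 q) (Z2 q)).
Proof.
move=> f1 f2; move: Z1 f1; apply: (field_along_ind smi).
- move=> Y1 v1; move: Z2 f2; apply: (field_along_ind smi).
  + move=> Y2 v2.
    apply: (smooth_fct_near_comp smi (G := fun r => g r (Y1 r) (Y2 r))).
    exact: smooth_metric_vfield.
  + move=> Z1 Z2 _ _ s1 s2; under eq_fun do rewrite metricDr.
    exact: smooth_fct_nearD.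
  + move=> a Z sa _ sZ; under eq_fun do rewrite metricZr.
    exact: (smooth_fct_near_scale sa sZ).
  + move=> Z1 Z2 _ E; apply: smooth_fct_near_ext.
    by apply: filterS E => q ->.
- move=> Z1 Z3 _ _ s1 s2; under eq_fun do rewrite metricDl.
  exact: smooth_fct_nearD.
- move=> a Z sa _ sZ; under eq_fun do rewrite metricZl.
  exact: (smooth_fct_near_scale sa sZ).
- move=> Z1 Z3 _ E; apply: smooth_fct_near_ext.
  by apply: filterS E => q ->.
Qed.

Variable nb : N -> 'rV[R]_k -> (N -> 'rV[R]_k) -> 'rV[R]_k.
Hypothesis lcN : is_levi_civita g nb.
Variable D : M -> 'rV[R]_n -> (M -> 'rV[R]_k) -> 'rV[R]_k.
Hypothesis pD : is_pullback_connection i nb D.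

Definition metric_compatible p v Z1 Z2 :=
  der (fun q => g (i q) (Z1 q) (Z2 q)) p v =
  g (i p) (D p v Z1) (Z2 p) + g (i p) (Z1 p) (D p v Z2).

Lemma metric_compatible_sym p v Z1 Z2 :
  metric_compatible p v Z1 Z2 -> metric_compatible p v Z2 Z1.
Proof.
rewrite /metric_compatible.
under eq_fun do rewrite (Defs.metric_sym gN).
rewrite [g (i p) _ (Z2 p)](Defs.metric_sym gN).
by rewrite [g (i p) (Z1 p) _](Defs.metric_sym gN) addrC.
Qed.

Lemma metric_compatible_ind p v Z2 : field_along_near i p Z2 ->
  (forall Y, vfield_near (i p) Y -> metric_compatible p v (Y \o i) Z2) ->
  forall Z1, field_along_near i p Z1 -> metric_compatible p v Z1 Z2.
Proof.
move=> f2 base; have [cD _] := pD; apply: (field_along_ind smi) => //.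
- rewrite /metric_compatible => Z1 Z3 f1 f3 s1 s3.
  under eq_fun do rewrite metricDl.
  rewrite derD; try exact: smooth_metric_along.
  by rewrite s1 s3 (connectionD cD)// !metricDl addrACA.
- rewrite /metric_compatible => a Z sa fZ sZ.
  under eq_fun do rewrite metricZl.
  have := der_scale v sa (smooth_metric_along fZ f2); rewrite /GRing.scale/= => ->.
  rewrite sZ (connection_leibniz cD)// metricDl !metricZl mulrDr addrA.
  by [].
- rewrite /metric_compatible => Z1 Z3 f1 E s1; rewrite -(connection_local cD v f1 E).
  rewrite -(nbhs_singleton E) -s1; apply/esym/near_eq_der.
    exact: smooth_metric_along.
  by apply: filterS E => q ->.
Qed.

(** By induction on both fields this reduces to restrictions of fields of [N],
where it follows from the chain rule and the compatibility of [nb] with [g]. *)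
Lemma pullback_metric_compatible p v Z1 Z2 :
  field_along_near i p Z1 -> field_along_near i p Z2 ->
  metric_compatible p v Z1 Z2.
Proof.
have [_ Dpull] := pD.
move=> f1 f2; move: Z1 f1; apply: metric_compatible_ind => // Y1 v1.
apply: metric_compatible_sym; move: Z2 f2; apply: metric_compatible_ind.
  exact: (field_along_near_pull smi).
move=> Y2 v2; rewrite /metric_compatible !Dpull//=.
rewrite -(levi_civita_metric lcN)//.
have sn := smooth_metric_vfield v2 v1.
exact: (der_comp smi v (smooth_fct_near_diff_at sn)).
Qed.

End Metric.

(** * Smoothness of matrix inversion *)

Section MatrixSmooth.
Variables (R : realType) (n : nat) (M : manifold R n).
Implicit Types p q : M.

Lemma smooth_fct_near_det m p (A : M -> 'M[R]_m) :
  (forall a b, smooth_fct_near p (fun q => A q a b)) ->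
  smooth_fct_near p (fun q => \det (A q)).
Proof.
move=> sA; rewrite /determinant; apply: smooth_fct_near_sum => s.
have sP := smooth_fct_near_prod (index_enum 'I_m) (fun a => sA a (s a)).
exact: (smooth_fct_near_scale (smooth_fct_near_cst p ((-1) ^+ s : R)) sP).
Qed.

(** By the formula with cofactors, the entries of the inverse are rational in
those of the matrix. *)
Lemma smooth_fct_near_invmx m p (A : M -> 'M[R]_m) a b :
  (forall a b, smooth_fct_near p (fun q => A q a b)) ->
  (\forall q \near p, A q \in unitmx) ->
  smooth_fct_near p (fun q => invmx (A q) a b).
Proof.
move=> sA uA.
apply: (@smooth_fct_near_ext _ _ _ _ _ (fun q => (\det (A q))^-1 *: cofactor (A q) b a)).
  by apply: filterS uA => q uq; rewrite /invmx uq !mxE.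
apply: smooth_fct_near_scale.
  apply: smooth_fct_near_inv; first exact: smooth_fct_near_det.
  by apply: filterS uA => q; rewrite unitmxE unitfE.
have sD : smooth_fct_near p (fun q => \det (row' b (col' a (A q)))).
  by apply: smooth_fct_near_det => c d; under eq_fun do rewrite !mxE.
exact: (smooth_fct_near_scale (smooth_fct_near_cst p ((-1) ^+ (b + a) : R)) sD).
Qed.

Lemma smooth_fct_near_row m p (f : M -> 'rV[R]_m) :
  (forall j, smooth_fct_near p (fun q => f q 0 j)) -> smooth_fct_near p f.
Proof.
move=> sf.
apply: (@smooth_fct_near_ext _ _ _ _ _ (fun q => \sum_j f q 0 j *: delta_mx 0 j)).
  by apply: nearW => q; rewrite -row_sum_delta.
apply: smooth_fct_near_sum => j.
by apply: smooth_fct_near_scale => //; exact: smooth_fct_near_cst.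
Qed.

Lemma smooth_fct_near_mulmx m p (c : M -> 'rV[R]_m) (A : M -> 'M[R]_m) :
  (forall j, smooth_fct_near p (fun q => c q 0 j)) ->
  (forall a b, smooth_fct_near p (fun q => A q a b)) ->
  smooth_fct_near p (fun q => c q *m A q).
Proof.
move=> sc sA; apply: smooth_fct_near_row => j; under eq_fun do rewrite mxE.
by apply: smooth_fct_near_sum => a; exact: (smooth_fct_near_scale (sc a)).
Qed.

End MatrixSmooth.

(** * Orthogonal projection and the Gauss formula *)

Section TangentialPart.
Variables (R : realType) (n m : nat).
Variables (N : manifold R m.*2.+1) (S : sasakian N) (M : manifold R n) (i : M -> N).
Hypothesis imi : immersion i.
Implicit Types p q : M.
Local Notation g := (Defs.metric S).
Local Notation dom p := (cdom (chart_at p)).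
Let smi : smooth_map i := proj1 imi.
Let gN : is_riemannian_metric g := sasakian_metric S.

Lemma tmapB p u v : tmap i p (u - v) = tmap i p u - tmap i p v.
Proof. by rewrite /tmap /der linearB. Qed.

Lemma tmap0 p : tmap i p 0 = 0.
Proof. by rewrite /tmap /der linear0. Qed.

Lemma tmap_eq0 p u : tmap i p u = 0 -> u = 0.
Proof. by rewrite -(tmap0 p) => /(proj2 imi p). Qed.

Lemma normal_tmap0 p u : normal_vector S i p (tmap i p u) -> u = 0.
Proof. by move=> /(_ u) /(metric_eq0 gN) /tmap_eq0. Qed.

Lemma normal_vectorB p w1 w2 : normal_vector S i p w1 -> normal_vector S i p w2 ->
  normal_vector S i p (w1 - w2).
Proof. by move=> n1 n2 u; rewrite (metricBl gN) n1 n2 subrr. Qed.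

(** Two such [u] differ by a tangent vector that is also normal, hence zero. *)
Lemma tan_part_unique p w u :
  normal_vector S i p (w - tmap i p u) -> tan_part S i p w = u.
Proof.
move=> nu; apply: xget_subset1 => // u1 u2 /= n1 n2.
apply/subr0_eq/(@normal_tmap0 p); rewrite tmapB.
have := normal_vectorB n2 n1.
by rewrite opprB addrC addrA subrK.
Qed.

Definition gram p q : 'M[R]_n := \matrix_(a, b)
  g (i q) (tmap i q (cfield p (delta_mx 0 a) q)) (tmap i q (cfield p (delta_mx 0 b) q)).

Definition gram_row p q w : 'rV[R]_n :=
  \row_b g (i q) w (tmap i q (cfield p (delta_mx 0 b) q)).

Lemma tmap_cfield p q c :
  tmap i q (cfield p c q) = \sum_a c 0 a *: tmap i q (cfield p (delta_mx 0 a) q).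
Proof.
rewrite {1}(row_sum_delta c) /tmap /der /cfield !linear_sum /=.
by apply: eq_bigr => a _; rewrite !linearZ.
Qed.

Lemma gram_mul p q c : c *m gram p q = gram_row p q (tmap i q (cfield p c q)).
Proof.
apply/rowP => b; rewrite !mxE tmap_cfield (metric_suml gN).
by apply: eq_bigr => a _; rewrite mxE.
Qed.

Lemma gram_row0 p q w : dom p q -> gram_row p q w = 0 -> normal_vector S i q w.
Proof.
move=> pq w0 u; rewrite -(cfield_der u pq) tmap_cfield (Defs.metric_sym gN).
rewrite (metric_suml gN) big1// => b _; rewrite (Defs.metric_sym gN).
by have /rowP/(_ b) := w0; rewrite !mxE => ->; rewrite mulr0.
Qed.

(** A row in the kernel of the Gram matrix gives a tangent vector orthogonal to
the whole frame, hence to itself. *)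
Lemma gram_unit p q : dom p q -> gram p q \in unitmx.
Proof.
move=> pq; rewrite -row_free_unit; apply: inj_row_free => c.
rewrite gram_mul => /(gram_row0 pq)/normal_tmap0 c0.
rewrite -(der_cfield c pq) c0; exact: (linear0 _).
Qed.

Lemma gram_residual_normal p q w : dom p q ->
  normal_vector S i q
    (w - tmap i q (cfield p (gram_row p q w *m invmx (gram p q)) q)).
Proof.
move=> pq; apply: (gram_row0 pq).
have -> w1 w2 : gram_row p q (w1 - w2) = gram_row p q w1 - gram_row p q w2.
  by apply/rowP => b; rewrite !mxE (metricBl gN).
by rewrite -gram_mul mulmxKV ?gram_unit// subrr.
Qed.

(** The normal equations: the components of the orthogonal projection are
obtained by solving a linear system with the Gram matrix. *)
Lemma tan_part_gram p q w : dom p q ->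
  tan_part S i q w = cfield p (gram_row p q w *m invmx (gram p q)) q.
Proof. by move=> pq; apply/tan_part_unique/gram_residual_normal. Qed.

Lemma nor_part_normal p w : normal_vector S i p (nor_part S i p w).
Proof.
have pp := mem_chart_at p; rewrite /nor_part (tan_part_gram _ pp).
exact: gram_residual_normal.
Qed.

Lemma tan_part_tmap p u : tan_part S i p (tmap i p u) = u.
Proof. by apply: tan_part_unique => v; rewrite subrr (metric0l gN). Qed.

Lemma tan_part_linear p : linear (tan_part S i p).
Proof.
move=> a u v; apply: tan_part_unique => w.
rewrite tmap_linear opprD addrACA -scalerBr.
rewrite (metricDl gN) (metricZl gN).
by rewrite (nor_part_normal p u w) (nor_part_normal p v w) mulr0 addr0.
Qed.

Lemma tan_partD p u v :
  tan_part S i p (u + v) = tan_part S i p u + tan_part S i p v.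
Proof. by have := tan_part_linear p 1 u v; rewrite !scale1r. Qed.

Lemma tan_partZ p a u : tan_part S i p (a *: u) = a *: tan_part S i p u.
Proof.
have t0 : tan_part S i p 0 = 0 by rewrite -(tmap0 p) tan_part_tmap.
by have := tan_part_linear p a u 0; rewrite t0 !addr0.
Qed.

Lemma tan_partB p u v :
  tan_part S i p (u - v) = tan_part S i p u - tan_part S i p v.
Proof. by rewrite tan_partD -scaleN1r tan_partZ scaleN1r. Qed.

Lemma metric_tan_part p w u :
  g (i p) (tmap i p (tan_part S i p w)) (tmap i p u) = g (i p) w (tmap i p u).
Proof.
have := nor_part_normal p w u; rewrite /nor_part (metricBl gN) => /eqP.
by rewrite subr_eq0 => /eqP.
Qed.

(** In the coordinate frame of the chart at [p], the projection has smooth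
components by [tan_part_gram] and the smoothness of matrix inversion. *)
Lemma vfield_near_tan_part p Z : field_along_near i p Z ->
  vfield_near p (fun q => tan_part S i q (Z q)).
Proof.
move=> fZ; apply/vfield_nearP.
apply: (@smooth_fct_near_ext _ _ _ _ _
  (fun q => gram_row p q (Z q) *m invmx (gram p q))).
  by apply: filterS (near_dom p) => q pq; rewrite (tan_part_gram _ pq) der_cfield.
have fE b : field_along_near i p (fun q => tmap i q (cfield p (delta_mx 0 b) q)).
  by apply: field_along_near_push => //; exact: vfield_near_cfield.
apply: smooth_fct_near_mulmx => [j|a b].
  by under eq_fun do rewrite mxE; exact: (smooth_metric_along gN smi).
apply: smooth_fct_near_invmx => [c d|].
  by under eq_fun do rewrite mxE; exact: (smooth_metric_along gN smi).
by apply: filterS (near_dom p) => q; exact: gram_unit.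
Qed.

Variable D : M -> 'rV[R]_n -> (M -> 'rV[R]_(m.*2.+1)) -> 'rV[R]_(m.*2.+1).
Hypothesis pD : is_pullback_connection i (lc S) D.
Variable nabla : M -> 'rV[R]_n -> (M -> 'rV[R]_n) -> 'rV[R]_n.
Hypothesis lcM : is_levi_civita (induced_metric S i) nabla.
Let lcN := sasakian_lc S.

(** Both sides are torsion-free and metric in the sense of Levi-Civita, and the
usual uniqueness argument applies to their difference [T]. *)
Lemma tan_part_pullback p X Y : vfield_near p X -> vfield_near p Y ->
  tan_part S i p (D p (X p) (push i Y)) = nabla p (X p) Y.
Proof.
pose T X Y := tan_part S i p (D p (X p) (push i Y)) - nabla p (X p) Y.
pose h u v := g (i p) (tmap i p u) (tmap i p v).
have Tsym X1 Y1 : vfield_near p X1 -> vfield_near p Y1 -> T X1 Y1 = T Y1 X1.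
  move=> vX vY; have := pullback_torsion_free smi lcN pD lcM vX vY.
  move=> /(congr1 (tan_part S i p)); rewrite tan_part_tmap tan_partB.
  move=> /(canRL (subrK _)); rewrite /T => ->.
  by rewrite addrAC [X in X + _]addrAC subrr add0r addrC.
have Tskew X1 Y1 Z1 : vfield_near p X1 -> vfield_near p Y1 -> vfield_near p Z1 ->
    h (T X1 Y1) (Z1 p) = - h (Y1 p) (T X1 Z1).
  move=> vX vY vZ; apply/eqP; rewrite -addr_eq0; apply/eqP.
  have := levi_civita_metric lcM (X1 p) vY vZ.
  have := pullback_metric_compatible gN smi lcN pD (X1 p)
    (field_along_near_push smi vY) (field_along_near_push smi vZ).
  rewrite /metric_compatible /induced_metric => -> E.
  rewrite /h /T !tmapB (metricBl gN) [X in _ + X](Defs.metric_sym gN) (metricBl gN).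
  rewrite !metric_tan_part addrACA -opprD.
  rewrite [in X in _ - (_ + X)](Defs.metric_sym gN) -E.
  by rewrite [in X in (_ + X) - _](Defs.metric_sym gN) subrr.
move=> vX vY; apply/subr0_eq/(@tmap_eq0 p)/(metric_eq0 gN (r := i p)).
have hC u v : h u v = h v u by exact: Defs.metric_sym.
rewrite -/(T X Y) -/(h _ _).
(* Skewness only speaks of values of fields, so [T X Y] is extended to one. *)
pose Z := cfield p (T X Y); have vZ : vfield_near p Z by exact: vfield_near_cfield.
have Zp : Z p = T X Y by exact: cfield_self.
(* Going around the three fields, symmetry and skewness alternate three times
   each: h(T(X,Y),Z) = - h(Y,T(X,Z)) = h(T(Z,Y),X) = - h(Z,T(Y,X)). *)
have E : h (T X Y) (Z p) = - h (T X Y) (Z p).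
  rewrite {1}(Tskew X Y Z)// (Tsym X Z)// hC (Tskew Z X Y)// (Tsym Z Y)//.
  by rewrite hC (Tskew Y Z X)// (Tsym Y X)// !opprK hC.
rewrite Zp in E; move/eqP: E; rewrite -addr_eq0 -mulr2n mulrn_eq0 /=.
by move=> /eqP.
Qed.

End TangentialPart.

(** * The Sasakian equation along a map *)

Section Structure.
Variables (R : realType) (n m : nat).
Variables (N : manifold R m.*2.+1) (S : sasakian N) (M : manifold R n) (i : M -> N).
Hypothesis smi : smooth_map i.
Implicit Types p q : M.
Local Notation g := (Defs.metric S).
Let gN : is_riemannian_metric g := sasakian_metric S.

Lemma phiD (r : N) u v : phi S r (u + v) = phi S r u + phi S r v.
Proof. by have := phi_linear S r 1 u v; rewrite !scale1r. Qed.

Lemma phi0 (r : N) : phi S r 0 = 0.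
Proof.
have := phiD r 0 0; rewrite addr0 => /(congr1 (fun x => x - phi S r 0)).
by rewrite addrK subrr.
Qed.

Lemma phiZ (r : N) a v : phi S r (a *: v) = a *: phi S r v.
Proof. by have := phi_linear S r a v 0; rewrite phi0 !addr0. Qed.

Lemma etaD (r : N) u v : eta S r (u + v) = eta S r u + eta S r v.
Proof. by have := eta_linear S r 1 u v; rewrite scale1r mul1r. Qed.

Lemma etaZ (r : N) a v : eta S r (a *: v) = a * eta S r v.
Proof.
have := etaD r 0 0; rewrite addr0 => /(congr1 (fun x => x - eta S r 0)).
rewrite addrK subrr => e0.
by have := eta_linear S r a v 0; rewrite -e0 !addr0.
Qed.

Lemma field_along_near_phi p Z : field_along_near i p Z ->
  field_along_near i p (fun q => phi S (i q) (Z q)).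
Proof.
move: Z; apply: (field_along_ind smi).
- move=> Y [U oU vU]; apply: (field_along_near_pull smi (Y := fun r => phi S r (Y r))).
  by exists U => //; apply: phi_smooth => //; case: oU.
- move=> Z1 Z2 _ _ f1 f2; under eq_fun do rewrite phiD.
  exact: (field_along_nearD smi).
- move=> a Z sa _ fZ; under eq_fun do rewrite phiZ.
  exact: (field_along_near_scale smi).
- move=> Z1 Z2 _ E; apply: (field_along_near_ext smi).
  by apply: filterS E => q ->.
Qed.

Variable D : M -> 'rV[R]_n -> (M -> 'rV[R]_(m.*2.+1)) -> 'rV[R]_(m.*2.+1).
Hypothesis pD : is_pullback_connection i (lc S) D.

(** Each side is compatible with sums and with products by functions (the terms
with the derivative of the function agree because [phi] is linear), so it is
enough to treat restrictions of fields of [N], where this is the Sasakian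
equation. *)
Lemma pullback_phi p v Z : field_along_near i p Z ->
  D p v (fun q => phi S (i q) (Z q)) = phi S (i p) (D p v Z)
    + (g (i p) (tmap i p v) (Z p) *: xi S (i p) - eta S (i p) (Z p) *: tmap i p v).
Proof.
have [cD Dpull] := pD; move: Z; apply: (field_along_ind smi).
- move=> Y vY; rewrite Dpull// -(lc_phi S)// addrC subrK.
  apply: (Dpull p v (fun r => phi S r (Y r))).
  by case: vY => U oU vU; exists U => //; apply: phi_smooth => //; case: oU.
- move=> Z1 Z2 f1 f2 E1 E2; under eq_fun do rewrite phiD.
  rewrite (connectionD cD)//; try exact: field_along_near_phi.
  rewrite E1 E2 (connectionD cD)// phiD (metricDr gN) etaD !scalerDl opprD.
  by rewrite addrACA [in X in _ + X]addrACA.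
- move=> a Z sa fZ E; under eq_fun do rewrite phiZ.
  rewrite (connection_leibniz cD)//; last exact: field_along_near_phi.
  rewrite E (connection_leibniz cD)// phiD !phiZ (metricZr gN) etaZ.
  by rewrite -!scalerA scalerDr scalerBr addrA.
- move=> Z1 Z2 f1 E; have <- : D p v Z1 = D p v Z2 by exact: (connection_local cD).
  rewrite -(nbhs_singleton E) => <-; apply/esym/(connection_local cD).
    exact: field_along_near_phi.
  by apply: filterS E => q ->.
Qed.

End Structure.

Theorem lemma5p9 (R : realType) (m n : nat)
    (N : manifold R m.*2.+1) (S : sasakian N)
    (M : manifold R n) (i : M -> N)
    (D : M -> 'rV[R]_n -> (M -> 'rV[R]_(m.*2.+1)) -> 'rV[R]_(m.*2.+1))
    (nabla : M -> 'rV[R]_n -> (M -> 'rV[R]_n) -> 'rV[R]_n) :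
  immersion i ->
  tangent_to_reeb S i ->
  is_pullback_connection i (lc S) D ->
  is_levi_civita (induced_metric S i) nabla ->
  (forall X Y : M -> 'rV[R]_n, vfield (M := M) X -> vfield (M := M) Y ->
     forall p : M,
     nablaP S i nabla X Y p =
       shape_operator S i D (fun q => opF S i q (Y q)) X p
       + opt S i p (second_fundamental_form S i D X Y p)
       + induced_metric S i p (X p) (Y p) *: tan_part S i p (xi S (i p))
       - eta S (i p) (push i Y p) *: X p)
  /\
  (P_parallel S i nabla <->
   forall X Y : M -> 'rV[R]_n, vfield (M := M) X -> vfield (M := M) Y ->
     forall p : M, shape_operator S i D (fun q => opF S i q (Y q)) X p
       + opt S i p (second_fundamental_form S i D X Y p)
       + induced_metric S i p (X p) (Y p) *: tan_part S i p (xi S (i p))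
       - eta S (i p) (push i Y p) *: X p = 0).
Proof.
move=> imi _ pD lcM; have [smi _] := imi; have [cD _] := pD.
set formula := (X in X /\ _).
suff nablaPE : formula.
  split=> //; split=> [par X Y vX vY p|par X Y vX vY p].
    by rewrite -nablaPE//; exact: par.
  by rewrite nablaPE//; exact: par.
move=> X Y /vfield_near_vfield vX /vfield_near_vfield vY p.
have {}vX := vX p; have {}vY := vY p.
have fY : field_along_near i p (push i Y) by exact: field_along_near_push.
have fphiY := field_along_near_phi S smi fY.
pose PY q := opP S i q (Y q); pose FY q := opF S i q (Y q).
have vPY : vfield_near p PY by exact: vfield_near_tan_part.
have fPY : field_along_near i p (push i PY) by exact: field_along_near_push.
have fFY : field_along_near i p FY.
  have s1 : smooth_fct_near p (fun=> -1 : R) by exact: smooth_fct_near_cst.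
  have f1 := field_along_near_scale smi s1 fPY.
  apply: (field_along_near_ext smi _ (field_along_nearD smi fphiY f1)).
  by apply: nearW => q; rewrite scaleN1r.
(* The tangential part of [D_X (phi (i_* Y))]: the Gauss formula gives the
   contribution of [P Y] and the Weingarten formula that of [F Y]. *)
have splitD : tan_part S i p (D p (X p) (fun q => phi S (i q) (push i Y q))) =
    nabla p (X p) PY - shape_operator S i D FY X p.
  rewrite -(tan_part_pullback imi pD lcM vX vPY) /shape_operator opprK.
  rewrite -tan_partD// -(connectionD cD)//; congr (tan_part _ _ _ (D _ _ _)).
  by apply/funext => q; rewrite /FY /opF /nor_part addrC subrK.
have DY : D p (X p) (push i Y) =
  tmap i p (nabla p (X p) Y) + second_fundamental_form S i D X Y p.
  rewrite /second_fundamental_form /nor_part.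
  by rewrite (tan_part_pullback imi pD lcM vX vY) addrC subrK.
rewrite (pullback_phi smi pD)// DY phiD 2!(tan_partD S imi) in splitD.
rewrite (tan_partB S imi) 2!(tan_partZ S imi) (tan_part_tmap S imi) in splitD.
rewrite /nablaP -/PY; move/esym/(canRL (subrK _)): splitD => ->.
rewrite -/(opP S i p _) -/(opt S i p _) -/(induced_metric S i p _ _).
by rewrite addrC !addrA addNr add0r addrC !addrA.
Qed.
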